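(* Let $\Gamma=\mathbb{Z}\omega_1+\mathbb{Z}\omega_2$ be a full-rank lattice in $\mathbb{C}$, $\nu>0$, and let $\chi$ be a pseudo-character on $\Gamma$ (relative to $\nu$). Assume that $\chi$ is real-valued. Then for all nonnegative integers $m,n,p,q$ such that $m+n+p+q$ is odd, $$\sum_{\gamma\in\Gamma}\chi(\gamma)\,\gamma^p\,\overline{\gamma}^q\,e^{-\frac{\nu}{2}|\gamma|^2}H^{\nu}_{m,n}(\gamma,\overline{\gamma})=0.$$
   Context: Pseudo-character: a map $\chi:\Gamma\to\{|\zeta|=1\}\subset\mathbb{C}$ with $\chi(\gamma+\gamma')=\chi(\gamma)\chi(\gamma')e^{\frac{\nu}{2}(\gamma\overline{\gamma'}-\overline{\gamma}\gamma')}$ for all $\gamma,\gamma'\in\Gamma$. Complex Hermite polynomials: $H^{\nu}_{m,n}(z,\overline{z})=(-1)^{m+n}e^{\nu|z|^2}\dfrac{\partial^{m+n}}{\partial\overline{z}^m\partial z^n}\big(e^{-\nu|z|^2}\big)$ for integers $m,n\ge 0$ (Wirtinger derivatives). *)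

(* Defs.v *)
From HB Require Import structures.
From mathcomp Require Import all_boot all_order all_algebra complex finmap.
From mathcomp Require Import all_classical all_reals all_analysis.
From mathcomp.analysis.showcase Require Import summability.

Set Implicit Arguments.
Unset Strict Implicit.
Unset Printing Implicit Defensive.
Import Order.TTheory GRing.Theory Num.Theory.
Import numFieldNormedType.Exports.
Local Open Scope classical_set_scope.
Local Open Scope ring_scope.
Local Open Scope complex_scope.

Definition cexp (R : realType) (z : R[i]) : R[i] :=
  (expR (complex.Re z))%:C * (cos (complex.Im z) +i* sin (complex.Im z)).

(* Partial derivatives with respect to x and y, where z = x + iy, taken
   separately on the real and imaginary parts of f. *)
Definition partialx (R : realType) (f : R[i] -> R[i]) (z : R[i]) : R[i] :=
  derive1 (fun x : R => complex.Re (f (x +i* complex.Im z))) (complex.Re z) +i*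
  derive1 (fun x : R => complex.Im (f (x +i* complex.Im z))) (complex.Re z).

Definition partialy (R : realType) (f : R[i] -> R[i]) (z : R[i]) : R[i] :=
  derive1 (fun y : R => complex.Re (f (complex.Re z +i* y))) (complex.Im z) +i*
  derive1 (fun y : R => complex.Im (f (complex.Re z +i* y))) (complex.Im z).

Definition wirtinger (R : realType) (f : R[i] -> R[i]) (z : R[i]) : R[i] :=
  (partialx f z - 'i%C * partialy f z) / 2%:R.

Definition wirtinger_conj (R : realType) (f : R[i] -> R[i]) (z : R[i]) : R[i] :=
  (partialx f z + 'i%C * partialy f z) / 2%:R.

Definition complex_hermite (R : realType) (nu : R) (m n : nat) (z : R[i])
    : R[i] :=
  (-1) ^+ (m + n) * cexp (nu%:C * `|z| ^+ 2) *
  iter m (@wirtinger_conj R)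
    (iter n (@wirtinger R) (fun w => cexp (- (nu%:C * `|w| ^+ 2)))) z.

Definition lattice (R : realType) (w1 w2 : R[i]) : set R[i] :=
  [set z | exists a b : int, z = a%:~R * w1 + b%:~R * w2].

Definition real_independent (R : realType) (w1 w2 : R[i]) : Prop :=
  forall a b : R, a%:C * w1 + b%:C * w2 = 0 -> a = 0 /\ b = 0.

(* A map on G is represented by a function on R[i] whose values off G are
   irrelevant. *)
Definition pseudo_character (R : realType) (nu : R) (G : set R[i])
    (chi : R[i] -> R[i]) : Prop :=
  (forall g, G g -> `|chi g| = 1) /\
  (forall g h, G g -> G h ->
     chi (g + h) =
     chi g * chi h * cexp (nu%:C / 2%:R * (g * h^*%C - g^*%C * h))).

(* Unordered sum over the set G: the net of the partial sums over the finite
   subsets of G, directed by inclusion, converges to s (in the plane this is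
   absolute convergence with sum s). *)
Definition has_sum_over (R : realType) (G : set R[i]) (f : R[i] -> R[i])
    (s : R[i]) : Prop :=
  partial_sum (fun g : set_type G => f (val g)) @ totally --> (s : (R[i])^o).

(* Main.v *)
Require Import Defs.
From HB Require Import structures.
From mathcomp Require Import all_boot all_order all_algebra complex finmap.
From mathcomp Require Import all_classical all_reals all_analysis.
From mathcomp.analysis.showcase Require Import summability.
From mathcomp Require Import ring lra zify.
Import Order.TTheory GRing.Theory Num.Theory.
Import numFieldNormedType.Exports.
Local Open Scope classical_set_scope.
Local Open Scope ring_scope.
Local Open Scope complex_scope.

(** A real-valued pseudo-character takes the values [1] and [-1], and the
    cocycle factor is trivial on the pair [(g, -g)], so it is an even function.
    Wirtinger derivatives map (polynomial in [z] and its conjugate) * Gaussian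
    to functions of the same shape with the opposite parity, so the summand is
    odd with respect to [g |-> -g].  It is dominated by
    [expR (k * |g| - nu / 2 * |g| ^+ 2)], hence by a product of two geometric
    sequences in the coordinates of [g]: the sum converges absolutely, and its
    terms cancel in pairs. *)

(** * Derivatives of complex-valued functions of a real variable *)

Lemma ReD (R : realType) (u v : R[i]) :
  complex.Re (u + v) = complex.Re u + complex.Re v.
Proof. by case: u v => [a b] [c d]. Qed.

Lemma ImD (R : realType) (u v : R[i]) :
  complex.Im (u + v) = complex.Im u + complex.Im v.
Proof. by case: u v => [a b] [c d]. Qed.

Lemma ReM (R : realType) (u v : R[i]) :
  complex.Re (u * v) = complex.Re u * complex.Re v - complex.Im u * complex.Im v.
Proof. by case: u v => [a b] [c d]. Qed.

Lemma ImM (R : realType) (u v : R[i]) :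
  complex.Im (u * v) = complex.Re u * complex.Im v + complex.Im u * complex.Re v.
Proof. by case: u v => [a b] [c d]. Qed.

(** Componentwise, to match the real derivatives that [partialx] and [partialy] take. *)
Definition is_cderive (R : realType) (f : R -> R[i]) (t : R) (d : R[i]) : Prop :=
  is_derive t 1 (fun x => complex.Re (f x)) (complex.Re d) /\
  is_derive t 1 (fun x => complex.Im (f x)) (complex.Im d).

Lemma is_cderive_cst (R : realType) (c : R[i]) (t : R) :
  is_cderive R (fun=> c) t 0.
Proof. by split; exact: is_derive_cst. Qed.

Lemma is_cderiveD (R : realType) (f g : R -> R[i]) (t : R) (df dg : R[i]) :
  is_cderive R f t df -> is_cderive R g t dg ->
  is_cderive R (fun x => f x + g x) t (df + dg).
Proof.
move=> [f1 f2] [g1 g2]; split.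
  rewrite ReD (_ : (fun x => _) = (fun x => complex.Re (f x)) + (fun x => complex.Re (g x))).
    exact: is_deriveD.
  by apply/funext => x; rewrite ReD.
rewrite ImD (_ : (fun x => _) = (fun x => complex.Im (f x)) + (fun x => complex.Im (g x))).
  exact: is_deriveD.
by apply/funext => x; rewrite ImD.
Qed.

Lemma is_cderiveM (R : realType) (f g : R -> R[i]) (t : R) (df dg : R[i]) :
  is_cderive R f t df -> is_cderive R g t dg ->
  is_cderive R (fun x => f x * g x) t (df * g t + f t * dg).
Proof.
move=> [f1 f2] [g1 g2]; split.
  rewrite (_ : (fun x => _) =
    (fun x => complex.Re (f x)) * (fun x => complex.Re (g x)) -
    (fun x => complex.Im (f x)) * (fun x => complex.Im (g x))); last first.
    by apply/funext => x; rewrite ReM.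
  apply: is_derive_eq; rewrite ReD !ReM /GRing.scale /=; ring.
rewrite (_ : (fun x => _) =
    (fun x => complex.Re (f x)) * (fun x => complex.Im (g x)) +
    (fun x => complex.Im (f x)) * (fun x => complex.Re (g x))); last first.
  by apply/funext => x; rewrite ImM.
apply: is_derive_eq; rewrite ImD !ImM /GRing.scale /=; ring.
Qed.

(** * Calculus of Wirtinger derivatives *)

(* [a] and [b] are the values at [z] of the derivatives of [f] with respect to
   [z] and to its conjugate. *)
Definition is_wirtinger (R : realType) (f : R[i] -> R[i]) (z a b : R[i]) : Prop :=
  is_cderive R (fun x => f (x +i* complex.Im z)) (complex.Re z) (a + b) /\
  is_cderive R (fun y => f (complex.Re z +i* y)) (complex.Im z) ('i%C * (a - b)).

Lemma is_wirtinger_partial (R : realType) (f : R[i] -> R[i]) (z a b : R[i]) :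
  is_wirtinger R f z a b ->
  partialx f z = a + b /\ partialy f z = 'i%C * (a - b).
Proof.
move=> [[x1 x2] [y1 y2]].
rewrite /partialx /partialy !derive1E.
rewrite (derive_val (is_derive := x1)) (derive_val (is_derive := x2)).
rewrite (derive_val (is_derive := y1)) (derive_val (is_derive := y2)).
by split; [case: (a + b)|case: ('i%C * _)].
Qed.

(** Inverts the relations between the partial derivatives and [a + b], [i (a - b)]. The total
    operators [wirtinger] and [wirtinger_conj] are thus computed from a certificate of
    differentiability. *)
Lemma is_wirtingerE (R : realType) (f : R[i] -> R[i]) (z a b : R[i]) :
  is_wirtinger R f z a b -> wirtinger f z = a /\ wirtinger_conj f z = b.
Proof.
move=> /is_wirtinger_partial[fx fy].
rewrite /wirtinger /wirtinger_conj fx fy mulrA -expr2 sqr_i.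
by split; field.
Qed.

Lemma is_wirtinger_cst (R : realType) (c z : R[i]) :
  is_wirtinger R (fun=> c) z 0 0.
Proof.
split; rewrite ?subrr ?mulr0 ?addr0; exact: is_cderive_cst.
Qed.

Lemma is_wirtinger_id (R : realType) (z : R[i]) : is_wirtinger R id z 1 0.
Proof.
rewrite /is_wirtinger addr0 subr0 mulr1.
by split; split; first [exact: is_derive_id | exact: is_derive_cst].
Qed.

Lemma is_wirtinger_conjc (R : realType) (z : R[i]) :
  is_wirtinger R (fun w => w^*%C) z 0 1.
Proof.
rewrite /is_wirtinger add0r sub0r mulrN1.
split; split => /=.
- exact: is_derive_id.
- exact: is_derive_cst.
- by rewrite oppr0; exact: is_derive_cst.
- exact: (@is_deriveN R R R id).
Qed.

Lemma is_wirtingerD (R : realType) (f g : R[i] -> R[i]) (z a b c d : R[i]) :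
  is_wirtinger R f z a b -> is_wirtinger R g z c d ->
  is_wirtinger R (fun w => f w + g w) z (a + c) (b + d).
Proof.
move=> [fx fy] [gx gy]; split.
  by rewrite addrACA; exact: (is_cderiveD R _ _ _ _ _ fx gx).
rewrite opprD addrACA mulrDr; exact: (is_cderiveD R _ _ _ _ _ fy gy).
Qed.

Lemma is_wirtingerM (R : realType) (f g : R[i] -> R[i]) (z a b c d : R[i]) :
  is_wirtinger R f z a b -> is_wirtinger R g z c d ->
  is_wirtinger R (fun w => f w * g w) z (a * g z + f z * c) (b * g z + f z * d).
Proof.
move=> [fx fy] [gx gy]; split.
  have := is_cderiveM R _ _ _ _ _ fx gx.
  have -> : complex.Re z +i* complex.Im z = z by case: (z).
  by congr is_cderive; ring.
have := is_cderiveM R _ _ _ _ _ fy gy.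
have -> : complex.Re z +i* complex.Im z = z by case: (z).
by congr is_cderive; ring.
Qed.

(** * The Gaussian and its derivatives *)

Definition gauss (R : realType) (nu : R) (w : R[i]) : R[i] :=
  cexp (- (nu%:C * `|w| ^+ 2)).

Lemma cexp_real (R : realType) (x : R) : cexp x%:C = (expR x)%:C.
Proof. by rewrite /cexp /= cos0 sin0 mulr1. Qed.

Lemma gaussE (R : realType) (nu : R) (w : R[i]) :
  gauss R nu w = (expR (- (nu * (complex.Re w ^+ 2 + complex.Im w ^+ 2))))%:C.
Proof. by rewrite /gauss -add_Re2_Im2 -rmorphM -rmorphN cexp_real. Qed.

Lemma is_derive_gauss (R : realType) (nu t c : R) :
  is_derive t 1 (fun x => expR (- (nu * (x ^+ 2 + c))))
    (- (2 * nu * t) * expR (- (nu * (t ^+ 2 + c)))).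
Proof.
pose h (x : R) := - (nu * (x ^+ 2 + c)).
have dh : is_derive t 1 h (- (2 * nu * t)).
  have -> : h = - (nu \*: ((id ^+ 2 : R -> R) + cst c)).
    by apply/funext.
  apply: is_derive_eq; rewrite /GRing.scale /=; ring.
have := is_derive1_comp (is_derive_expR (h t)) dh.
by rewrite mulrC.
Qed.

Lemma is_cderive_real (R : realType) (f : R -> R) (t d : R) :
  is_derive t 1 f d -> is_cderive R (fun x => (f x)%:C) t d%:C.
Proof. by move=> df; split=> //; exact: is_derive_cst. Qed.

(** The squared modulus is the product of [z] and its conjugate, so differentiating the exponent in
    one of them leaves [- nu] times the other. The check is made on real parts, one axis at a
    time. *)
Lemma is_wirtinger_gauss (R : realType) (nu : R) (z : R[i]) :
  is_wirtinger R (gauss R nu) z (- nu%:C * (z^*%C * gauss R nu z))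
    (- nu%:C * (z * gauss R nu z)).
Proof.
have -> : gauss R nu = fun w =>
    (expR (- (nu * (complex.Re w ^+ 2 + complex.Im w ^+ 2))))%:C.
  by apply/funext => w; exact: gaussE.
case: z => a b; split.
  have := is_cderive_real R _ _ _ (is_derive_gauss R nu a (b ^+ 2)).
  rewrite [complex.Re (a +i* b)]/= [complex.Im (a +i* b)]/=; set E := expR (- (nu * (a ^+ 2 + _))).
  by congr is_cderive; apply/eqP; rewrite eq_complex /=; apply/andP; split; apply/eqP; ring.
have := is_cderive_real R _ _ _ (is_derive_gauss R nu b (a ^+ 2)).
rewrite [complex.Re (a +i* b)]/= [complex.Im (a +i* b)]/= [b ^+ 2 + _]addrC.
set E := expR (- (nu * (a ^+ 2 + _))) => H.
rewrite (_ : (fun y => _) = fun y => (expR (- (nu * (y ^+ 2 + a ^+ 2))))%:C).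
  move: H; congr is_cderive; apply/eqP; rewrite eq_complex /=.
  by apply/andP; split; apply/eqP; ring.
by apply/funext => y /=; rewrite addrC.
Qed.

(** * Polynomials times the Gaussian: stability and parity *)

(* Products of a polynomial in [z] and its conjugate by the Gaussian; the
   boolean is [true] when the polynomial is odd, [false] when it is even. *)
Inductive gauss_poly (R : realType) (nu : R) : bool -> (R[i] -> R[i]) -> Prop :=
| gauss_poly_gauss : gauss_poly R nu false (gauss R nu)
| gauss_polyZ c b f : gauss_poly R nu b f -> gauss_poly R nu b (fun z => c * f z)
| gauss_polyD b f g : gauss_poly R nu b f -> gauss_poly R nu b g ->
    gauss_poly R nu b (fun z => f z + g z)
| gauss_poly_mul b f : gauss_poly R nu b f ->
    gauss_poly R nu (~~ b) (fun z => z * f z)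
| gauss_poly_conj b f : gauss_poly R nu b f ->
    gauss_poly R nu (~~ b) (fun z => z^*%C * f z).

(** By the product rule, a derivative either removes a factor [z] or its conjugate, or brings one
    down from the Gaussian; both flip the parity. Differentiability at every point is carried along,
    which makes iteration possible. *)
Lemma gauss_poly_is_wirtinger (R : realType) (nu : R) (b : bool) (f : R[i] -> R[i]) :
  gauss_poly R nu b f -> exists f1 f2, [/\ gauss_poly R nu (~~ b) f1,
    gauss_poly R nu (~~ b) f2 & forall z, is_wirtinger R f z (f1 z) (f2 z)].
Proof.
elim=> {b f} [|c b f _ [f1 [f2 [h1 h2 hf]]]
  |b f g _ [f1 [f2 [h1 h2 hf]]] _ [g1 [g2 [k1 k2 hg]]]
  |b f bf [f1 [f2 [h1 h2 hf]]]|b f bf [f1 [f2 [h1 h2 hf]]]].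
- eexists _, _; split; last by move=> z; exact: is_wirtinger_gauss.
    by apply/gauss_polyZ/(gauss_poly_conj _ _ false); exact: gauss_poly_gauss.
  by apply/gauss_polyZ/(gauss_poly_mul _ _ false); exact: gauss_poly_gauss.
- exists (fun z => c * f1 z), (fun z => c * f2 z); split; try exact: gauss_polyZ.
  move=> z; have := is_wirtingerM R _ _ _ _ _ _ _ (is_wirtinger_cst R c z) (hf z).
  by rewrite !mul0r !add0r.
- exists (fun z => f1 z + g1 z), (fun z => f2 z + g2 z); split; try exact: gauss_polyD.
  by move=> z; exact: is_wirtingerD.
(* The function [z * f z] has parity [~~ b], so its derivatives must have parity [b]: this is the
   parity of [f], and that of [z * f1 z] after a double negation. *)
- exists (fun z => f z + z * f1 z), (fun z => z * f2 z); rewrite negbK; split.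
  + by apply: gauss_polyD => //; rewrite -[b]negbK; exact: gauss_poly_mul.
  + by rewrite -[b]negbK; exact: gauss_poly_mul.
  + move=> z; have := is_wirtingerM R _ _ _ _ _ _ _ (is_wirtinger_id R z) (hf z).
    by rewrite mul1r mul0r add0r.
- exists (fun z => z^*%C * f1 z), (fun z => f z + z^*%C * f2 z); rewrite negbK; split.
  + by rewrite -[b]negbK; exact: gauss_poly_conj.
  + by apply: gauss_polyD => //; rewrite -[b]negbK; exact: gauss_poly_conj.
  + move=> z; have := is_wirtingerM R _ _ _ _ _ _ _ (is_wirtinger_conjc R z) (hf z).
    by rewrite mul1r mul0r add0r.
Qed.

Lemma gauss_poly_wirtinger (R : realType) (nu : R) (b : bool) (f : R[i] -> R[i]) :
  gauss_poly R nu b f ->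
  gauss_poly R nu (~~ b) (@wirtinger R f) /\
  gauss_poly R nu (~~ b) (@wirtinger_conj R f).
Proof.
move=> /gauss_poly_is_wirtinger[f1 [f2 [h1 h2 hf]]].
have /funext -> : wirtinger f =1 f1 by move=> z; have [] := is_wirtingerE R _ _ _ _ (hf z).
by have /funext -> : wirtinger_conj f =1 f2
  by move=> z; have [] := is_wirtingerE R _ _ _ _ (hf z).
Qed.

(** The operator is abstract because the lemma serves both for the two derivations and for
    multiplication by [z] or by its conjugate. *)
Lemma gauss_poly_iter (R : realType) (nu : R)
    (T : (R[i] -> R[i]) -> R[i] -> R[i]) (n : nat) (b : bool) (f : R[i] -> R[i]) :
  (forall b f, gauss_poly R nu b f -> gauss_poly R nu (~~ b) (T f)) ->
  gauss_poly R nu b f -> gauss_poly R nu (odd n (+) b) (iter n T f).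
Proof.
by move=> hT hf; elim: n => //= n /hT; rewrite -addNb.
Qed.

Lemma gauss_poly_monomial (R : realType) (nu : R) (p q : nat) (b : bool)
    (f : R[i] -> R[i]) :
  gauss_poly R nu b f ->
  gauss_poly R nu (odd (p + q) (+) b) (fun z => z ^+ p * z^*%C ^+ q * f z).
Proof.
move=> hf; rewrite oddD -addbA.
have -> : (fun z => z ^+ p * z^*%C ^+ q * f z) =
  iter p (fun g z => z * g z) (iter q (fun g z => z^*%C * g z) f).
  apply/funext => z; elim: p => [|p IHp].
    rewrite mul1r /=; elim: q => [|q IHq]; first by rewrite mul1r.
    by rewrite exprS -mulrA IHq.
  by rewrite exprS -2!mulrA [_ ^+ p * (_ * _)]mulrA IHp.
by apply: gauss_poly_iter => [*|]; [exact: gauss_poly_mul|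
  apply: gauss_poly_iter => // *; exact: gauss_poly_conj].
Qed.

Lemma gauss_poly_parity (R : realType) (nu : R) (b : bool) (f : R[i] -> R[i]) :
  gauss_poly R nu b f -> forall z, f (- z) = (-1) ^+ b * f z.
Proof.
elim=> {b f} [|c b f _ IH|b f g _ IHf _ IHg|b f _ IH|b f _ IH] z.
- by rewrite mul1r /gauss normrN.
- by rewrite IH mulrCA.
- by rewrite IHf IHg mulrDr.
- by rewrite IH; case: b {IH} => /=; ring.
- by rewrite IH rmorphN; case: b {IH} => /=; ring.
Qed.

(** * The real-valued modulus and Gaussian growth bounds *)

Lemma normc_normc (R : realType) (z : R[i]) : `|z| = (Normc.normc z)%:C.
Proof. by case: z. Qed.

Lemma normc_ge0 (R : realType) (z : R[i]) : 0 <= Normc.normc z.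
Proof. by rewrite -ler0c -normc_normc. Qed.

Lemma normc_real (R : realType) (x : R) : Normc.normc x%:C = `|x|.
Proof. by rewrite /= expr0n addr0 sqrtr_sqr. Qed.

Lemma normcD (R : realType) (z w : R[i]) :
  Normc.normc (z + w) <= Normc.normc z + Normc.normc w.
Proof. exact: le_normcD. Qed.

Lemma normc_conjc (R : realType) (z : R[i]) : Normc.normc z^*%C = Normc.normc z.
Proof. by case: z => a b /=; rewrite sqrrN. Qed.

Lemma sqr_Re_Im (R : realType) (z : R[i]) :
  complex.Re z ^+ 2 + complex.Im z ^+ 2 = Normc.normc z ^+ 2.
Proof. by apply: complexI; rewrite add_Re2_Im2 normc_normc rmorphXn. Qed.

Lemma le_id_expR (R : realType) (x : R) : x <= expR x.
Proof. by have := expR_ge1Dx x; lra. Qed.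

(** Each factor [z] or conjugate is absorbed by [x <= expR x], which raises the linear rate [k] by
    one; the Gaussian rate [nu] never changes. *)
Lemma gauss_poly_bound (R : realType) (nu : R) (b : bool) (f : R[i] -> R[i]) :
  gauss_poly R nu b f -> exists K k, [/\ 0 <= K, 0 <= k & forall z,
    Normc.normc (f z) <=
      K * expR (k * Normc.normc z - nu * Normc.normc z ^+ 2)].
Proof.
elim=> {b f} [|c b f _ [K [k [K0 k0 IH]]]|b f g _ [K [k [K0 k0 IH]]] _ [L [l [L0 l0 IHg]]]
    |b f _ [K [k [K0 k0 IH]]]|b f _ [K [k [K0 k0 IH]]]].
- exists 1, 0; split=> // z.
  by rewrite gaussE sqr_Re_Im normc_real mul1r mul0r add0r ger0_norm ?expR_ge0.
- exists (Normc.normc c * K), k; split => // [|z]; first by rewrite mulr_ge0 ?normc_ge0.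
  by rewrite Normc.normcM -mulrA ler_wpM2l ?normc_ge0.
(* The rate [k + l] dominates both [k] and [l], since the rates are nonnegative. *)
- exists (K + L), (k + l); split; rewrite ?addr_ge0// => z.
  apply: le_trans (normcD _ _ _) _; rewrite mulrDl lerD//.
    apply: le_trans (IH z) _; rewrite ler_wpM2l// ler_expR lerD2r.
    by rewrite ler_wpM2r ?normc_ge0// lerDl.
  apply: le_trans (IHg z) _; rewrite ler_wpM2l// ler_expR lerD2r.
  by rewrite ler_wpM2r ?normc_ge0// lerDr.
- exists K, (1 + k); split => // [|z]; first by rewrite addr_ge0.
  rewrite Normc.normcM mulrDl mul1r -addrA expRD mulrCA.
  by apply: ler_pM; rewrite ?normc_ge0 ?le_id_expR.
- exists K, (1 + k); split => // [|z]; first by rewrite addr_ge0.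
  rewrite Normc.normcM normc_conjc mulrDl mul1r -addrA expRD mulrCA.
  by apply: ler_pM; rewrite ?normc_ge0 ?le_id_expR.
Qed.

(** * Finite partial sums: geometric domination and cancellation *)

Lemma sum_uniq_le (R : realType) (I : eqType) (s s' : seq I) (F : I -> R) :
  uniq s -> uniq s' -> {subset s <= s'} -> (forall i, 0 <= F i) ->
  \sum_(i <- s) F i <= \sum_(i <- s') F i.
Proof.
move=> us us' ss' F0.
have ss'E : perm_eq s [seq i <- s' | i \in s].
  apply: uniq_perm => // [|i]; first exact: filter_uniq.
  by rewrite mem_filter; case: (boolP (i \in s)) => // /ss' ->.
rewrite (perm_big _ ss'E) big_filter big_mkcond /=; apply: ler_sum => i _.
by case: ifP.
Qed.

(** Finitely many distinct pairs fit in a square, over which the sum factors as the square of a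
    partial geometric sum. *)
Lemma sum_geometric2_le (R : realType) (x : R) (s : seq (nat * nat)) :
  0 < x -> x < 1 -> uniq s ->
  \sum_(i <- s) x ^+ (i.1 + i.2) <= (1 - x)^-1 ^+ 2.
Proof.
move=> x0 x1 us.
have ge0X n : 0 <= x ^+ n by rewrite exprn_ge0// ltW.
have [N leN] : exists N, forall i, i \in s -> (i.1 + i.2 < N)%N.
  exists (\sum_(i <- s) (i.1 + i.2)).+1%N => i si.
  by rewrite ltnS (big_rem _ si) /= leq_addr.
apply: (@le_trans _ _
    (\sum_(i <- [seq (a, b) | a <- iota 0 N, b <- iota 0 N]) x ^+ (i.1 + i.2))).
  apply: sum_uniq_le => //.
    by apply: allpairs_uniq; rewrite ?iota_uniq// => -[? ?] [? ?] _ _ [-> ->].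
  move=> [a b] /leN /= abN; apply/allpairsP; exists (a, b).
  by rewrite !mem_iota /=; split=> //; apply: leq_ltn_trans abN; rewrite (leq_addr, leq_addl).
rewrite big_allpairs.
have -> : \sum_(a <- iota 0 N) \sum_(b <- iota 0 N) x ^+ (a + b) =
    (\sum_(a <- iota 0 N) x ^+ a) ^+ 2.
  rewrite expr2 mulr_suml; apply: eq_bigr => a _.
  by rewrite mulr_sumr; apply: eq_bigr => b _; rewrite exprD.
rewrite lerXn2r ?nnegrE ?sumr_ge0 ?invr_ge0 ?subr_ge0 ?(ltW x1)//.
have := @geometric_le_lim R N 1 x ler01 x0.
rewrite (ger0_norm (ltW x0)) => /(_ x1); rewrite mul1r; apply: le_trans.
rewrite /series /= /index_iota subn0.
by under [leRHS]eq_bigr do rewrite mul1r.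
Qed.

(** Bounded absolute sums have a supremum, nearly attained on some finite set. Once this set is made
    stable under [s], its terms cancel, and what any larger set adds is small. *)
Lemma partial_sum_odd_cvg0 (R : realType) (T : choiceType) (f : T -> R[i])
    (s : T -> T) (M : R) :
  involutive s -> (forall x, f (s x) = - f x) ->
  (forall A : {fset T}, \sum_(x <- A) Normc.normc (f x) <= M) ->
  partial_sum f @ totally --> (0 : (R[i])^o).
Proof.
move=> sK fs fM; set N := fun x => Normc.normc (f x).
have N0 x : 0 <= N x by exact: normc_ge0.
pose S := [set y | exists A : {fset T}, y = \sum_(x <- A) N x].
have hS : has_sup S.
  split; first by exists (\sum_(x <- fset0) N x); exists fset0.
  by exists M => _ [A ->]; exact: fM.
have FF : Filter (@totally T) by exact: totally_filter.
(* The radius [eps] is a complex number; being positive forces it to be real. *)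
apply/(@cvgrPdist_le _ (R[i])^o) => eps; rewrite ltcE => /andP[/eqP/= eI eR].
have -> : eps = (complex.Re eps)%:C by case: eps eI {eR} => a b /= ->.
have [_ [A0 ->] hA0] := sup_adherent eR hS.
have [A1 A01 sA1] : exists2 A1, (A0 `<=` A1)%fset &
    forall x, (s x \in A1) = (x \in A1).
  exists (A0 `|` [fset s x | x in A0])%fset; first exact: fsubsetUl.
  move=> x; rewrite !inE orbC; congr orb.
    by apply/imfsetP/idP => [[y /= yA] /(can_inj sK) -> //|xA]; exists x.
  apply/idP/imfsetP => [xA|[y /= yA ->]]; last by rewrite sK.
  by exists (s x); rewrite ?sK.
exists A1 => // A /= A1A.
rewrite sub0r normrN /partial_sum -(big_seq_fsetE _ _ xpredT f) /=.
(* Reindexing along [s], which permutes [A1], makes the sum equal to its own opposite; fixed points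
   of [s] need no separate treatment. *)
have f0 : \sum_(x <- A1) f x = 0.
  have E : \sum_(x <- A1) f x = - \sum_(x <- A1) f x.
    rewrite -sumrN -[in LHS](_ : map s (map s A1) = A1 :> seq T); last first.
      by rewrite -map_comp (eq_map (g := id)) ?map_id// => x /=; rewrite sK.
    rewrite big_map; under eq_bigr do rewrite fs.
    apply: perm_big; apply: uniq_perm => //.
      by rewrite map_inj_uniq//; exact: can_inj sK.
    move=> x; rewrite -[x in LHS]sK mem_map; last exact: can_inj sK.
    by rewrite sA1.
  by move/eqP: E; rewrite -addr_eq0 -mulr2n mulrn_eq0 /= => /eqP.
rewrite (big_fsetID _ (mem A1)) /=.
rewrite (_ : [fset x in A | x \in A1]%fset = A1); last first.
  by apply/fsetP => x; rewrite !inE andb_idl// => xA1; exact: (fsubsetP A1A).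
rewrite f0 add0r.
apply: le_trans (ler_norm_sum _ _ _) _.
under eq_bigr do rewrite normc_normc.
rewrite -rmorph_sum /= lecR.
(* [B] is disjoint from [A0], so the masses of [A0] and [B] add up to at most the supremum, while
   that of [A0] alone exceeds the supremum minus [eps]. *)
set B := [fset x in A | x \notin A1]%fset.
have /(sup_upper_bound hS) : S (\sum_(x <- (A0 `|` B)%fset) N x) by exists (A0 `|` B)%fset.
rewrite (big_fsetID _ (mem A0)) /=.
rewrite (_ : [fset x in (A0 `|` B)%fset | x \in A0]%fset = A0); last first.
  by apply/fsetP => x; rewrite !inE /= andbC; case: (x \in A0).
rewrite (_ : [fset x in (A0 `|` B)%fset | x \notin A0]%fset = B); last first.
  apply/fsetP => x; rewrite !inE /=.
  case: (boolP (x \in A0)) => [/(fsubsetP A01) ->|_]; by rewrite ?andbF ?andbT.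
by rewrite -/N; lra.
Qed.

(** * Lattice coordinates and absolute summability *)

Lemma abs_Im_le_normc (R : realType) (z : R[i]) : `|complex.Im z| <= Normc.normc z.
Proof.
case: z => a b /=; rewrite -sqrtr_sqr ler_wsqrtr// lerDr; exact: sqr_ge0.
Qed.

(** Cramer's rule: multiplying [a w1 + b w2] by the conjugate of one generator and taking imaginary
    parts isolates the coordinate of the other, up to sign and the determinant [D]. *)
Lemma lattice_coord_le (R : realType) (w1 w2 : R[i]) :
  real_independent w1 w2 -> exists2 L, 0 <= L & forall a b : R,
    `|a| <= L * Normc.normc (a%:C * w1 + b%:C * w2) /\
    `|b| <= L * Normc.normc (a%:C * w1 + b%:C * w2).
Proof.
case: w1 w2 => [x1 y1] [x2 y2] ind.
have ind0 a b : a * x1 + b * x2 = 0 -> a * y1 + b * y2 = 0 -> a = 0 /\ b = 0.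
  move=> h1 h2; apply: ind; apply/eqP; rewrite eq_complex /=.
  by apply/andP; split; apply/eqP; [rewrite -[RHS]h1|rewrite -[RHS]h2]; ring.
have D0 : x1 * y2 - x2 * y1 != 0.
  (* If the determinant vanished, the pair [(y2, - y1)] would give a linear relation, so [y1] and
     [y2] would be zero; likewise [x1] and [x2] through [(x2, - x1)]. Both generators would then be
     zero, and [(1, 1)] a forbidden relation. *)
  apply/eqP => D0.
  have [] := ind0 y2 (- y1); [by rewrite -[RHS]D0; ring|ring|].
  move=> y20 /eqP; rewrite oppr_eq0 => /eqP y10.
  have [] := ind0 x2 (- x1); [ring|by rewrite y10 y20; ring|].
  move=> x20 /eqP; rewrite oppr_eq0 => /eqP x10.
  have [] := ind0 1 1; rewrite ?x10 ?x20 ?y10 ?y20 ?mulr0 ?addr0// => /eqP.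
  by rewrite oner_eq0.
set D := x1 * y2 - _ in D0.
have nD : 0 < `|D| by rewrite normr_gt0.
pose W := Normc.normc (x1 +i* y1) + Normc.normc (x2 +i* y2).
have W0 : 0 <= W by rewrite addr_ge0 ?normc_ge0.
have coord_le (c : R) (u z : R[i]) :
    c * D = complex.Im (u * z) -> Normc.normc u <= W ->
    `|c| <= W / `|D| * Normc.normc z.
  move=> cD uW; rewrite mulrAC ler_pdivlMr// -normrM cD.
  apply: le_trans (abs_Im_le_normc _ _) _.
  by rewrite Normc.normcM ler_wpM2r ?normc_ge0.
exists (W / `|D|) => [|a b]; first by rewrite divr_ge0.
split.
  apply: (coord_le _ (- (x2 -i* y2))); first by rewrite /D /=; ring.
  have -> : - (x2 -i* y2) = - (x2 +i* y2)^*%C by [].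
  by rewrite normcN normc_conjc /W lerDr normc_ge0.
apply: (coord_le _ (x1 -i* y1)); first by rewrite /D /=; ring.
have -> : x1 -i* y1 = (x1 +i* y1)^*%C by [].
by rewrite normc_conjc /W lerDl normc_ge0.
Qed.

(** A code of linear growth: it turns a sum over integer coordinates into one over pairs of
    naturals, at the cost of a factor 2 in size. *)
Definition nat_of_int (a : int) : nat :=
  match a with Posz n => n.*2 | Negz n => n.*2.+1 end.

Lemma nat_of_int_inj : injective nat_of_int.
Proof.
by case=> a [] b /= E; try (by congr (_ _); lia); lia.
Qed.

Lemma nat_of_int_le (a : int) : (nat_of_int a <= `|a|.*2)%N.
Proof. by case: a => a //=; rewrite doubleS. Qed.

Lemma completing_square_le (R : realType) (nu c r : R) :
  0 < nu -> c * r - nu / 2 * r ^+ 2 <= c ^+ 2 / (2 * nu).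
Proof.
move=> nu0; rewrite -subr_ge0.
have -> : c ^+ 2 / (2 * nu) - (c * r - nu / 2 * r ^+ 2) =
  (c - nu * r) ^+ 2 / (2 * nu) by field; rewrite gt_eqF.
by rewrite divr_ge0 ?sqr_ge0// mulr_ge0// ltW.
Qed.

(** Coordinates are at most linear in [|g|], so geometric decay in their codes costs only a linear
    term in the exponent, which the Gaussian absorbs by completing the square. *)
Lemma lattice_sum_bounded (R : realType) (w1 w2 : R[i]) (nu K k : R)
    (f : set_type (lattice w1 w2) -> R[i]) :
  real_independent w1 w2 -> 0 < nu -> 0 <= K ->
  (forall g, Normc.normc (f g) <=
    K * expR (k * Normc.normc (val g) - nu / 2 * Normc.normc (val g) ^+ 2)) ->
  exists M, forall A : {fset set_type (lattice w1 w2)},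
    \sum_(g <- A) Normc.normc (f g) <= M.
Proof.
move=> /lattice_coord_le[L L0 hL] nu0 K0 hf.
have /choice[ca hca] (g : set_type (lattice w1 w2)) :
    exists c : int * int, val g = c.1%:~R * w1 + c.2%:~R * w2.
  by have := valP g; rewrite inE => -[a [b ab]]; exists (a, b).
pose h g := (nat_of_int (ca g).1, nat_of_int (ca g).2).
have h_inj : injective h.
  move=> g g' [/nat_of_int_inj e1 /nat_of_int_inj e2].
  by apply: val_inj; rewrite /= !hca e1 e2.
pose q : R := expR (-1).
(* With [r] the modulus of [g], each of the two codes is at most [2 L r]; writing out [q] to the
   power of their sum therefore needs an extra [4 L r] in the exponent. *)
pose C := K * expR ((k + 4 * L) ^+ 2 / (2 * nu)).
have C0 : 0 <= C by rewrite mulr_ge0 ?expR_ge0.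
have f_le g : Normc.normc (f g) <= C * q ^+ ((h g).1 + (h g).2).
  apply: le_trans (hf g) _; rewrite /C -[leRHS]mulrA ler_wpM2l// -expRM_natl -expRD ler_expR.
  set r := Normc.normc (val g).
  have intE (a : int) : `|a%:~R : R| = (`|a|%N)%:R by rewrite natr_absz intr_norm.
  have [] := hL (ca g).1%:~R (ca g).2%:~R.
  rewrite !rmorph_int -hca -/r !intE => l1 l2.
  have code_le (a : int) : (`|a|%N)%:R <= L * r -> (nat_of_int a)%:R <= 2 * (L * r).
    move=> ar; apply: (@le_trans _ _ (`|a|.*2)%:R); first by rewrite ler_nat nat_of_int_le.
    by rewrite -mul2n natrM ler_wpM2l.
  have := completing_square_le R nu (k + 4 * L) r nu0.
  have := code_le _ l1; have := code_le _ l2.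
  rewrite natrD /h /=; lra.
exists (C * (1 - q)^-1 ^+ 2) => A.
apply: le_trans (ler_sum _ (fun g _ => f_le g)) _.
rewrite -mulr_sumr ler_wpM2l//.
rewrite -(big_map h xpredT (fun i => q ^+ (i.1 + i.2))).
apply: sum_geometric2_le; rewrite ?expR_gt0//.
  by rewrite expR_lt1; lra.
by rewrite (map_inj_uniq h_inj) fset_uniq.
Qed.

(** * Symmetry under negation and vanishing of the sum *)

Lemma latticeN (R : realType) (w1 w2 z : R[i]) : lattice w1 w2 z -> lattice w1 w2 (- z).
Proof.
by move=> [a [b ->]]; exists (- a), (- b); rewrite !rmorphN; ring.
Qed.

Lemma lattice0 (R : realType) (w1 w2 : R[i]) : lattice w1 w2 0.
Proof. by exists 0, 0; rewrite !mul0r addr0. Qed.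

Lemma real_pseudo_character_even (R : realType) (w1 w2 : R[i]) (nu : R)
    (chi : R[i] -> R[i]) :
  pseudo_character nu (lattice w1 w2) chi ->
  (forall g, lattice w1 w2 g -> chi g \is Num.real) ->
  forall g, lattice w1 w2 g -> chi (- g) = chi g.
Proof.
move=> [chi1 chiD] chiR g lg.
have L0 := lattice0 R w1 w2; have lNg := latticeN _ _ _ _ lg.
have cexp0 : cexp (0 : R[i]) = 1 by rewrite -[0]/(0%:C) cexp_real expR0.
have chi_neq0 z : lattice w1 w2 z -> chi z != 0.
  by move=> /chi1 z1; rewrite -normr_eq0 z1 oner_eq0.
(* The cocycle relation at [(0, 0)] reads [chi 0 = chi 0 * chi 0], and [chi 0] can be cancelled. *)
have chi0 : chi 0 = 1.
  have := chiD _ _ L0 L0; rewrite addr0 mul0r mulr0 subr0 mulr0 cexp0 mulr1.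
  by move=> E; apply: (mulfI (chi_neq0 _ L0)); rewrite mulr1 -E.
have chi2 : chi g * chi g = 1.
  by rewrite -expr2 -real_normK ?chiR// chi1// expr1n.
(* After multiplication by [chi g], both sides equal 1: the left one is [chi 0] because the exponent
   of the cocycle is zero on [(g, - g)], the right one is [chi2]. *)
apply: (mulfI (chi_neq0 _ lg)); rewrite chi2 -chi0 -(subrr g) (chiD _ _ lg lNg).
rewrite [X in cexp X](_ : _ = 0) ?cexp0 ?mulr1//.
by rewrite rmorphN; ring.
Qed.

Theorem theorem2p4 (R : realType) (w1 w2 : R[i]) (nu : R) (chi : R[i] -> R[i])
    (w_indep : real_independent w1 w2) (nu_gt0 : 0 < nu)
    (chi_pseudo : pseudo_character nu (lattice w1 w2) chi)
    (chi_real : forall g, lattice w1 w2 g -> chi g \is Num.real)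
    (m n p q : nat) (mnpq_odd : odd (m + n + p + q)) :
  has_sum_over (lattice w1 w2)
    (fun g => chi g * g ^+ p * (g^*%C) ^+ q *
       cexp (- (nu%:C / 2%:R * `|g| ^+ 2)) * complex_hermite nu m n g)
    0.
Proof.
pose F z := z ^+ p * z^*%C ^+ q *
  iter m (@wirtinger_conj R) (iter n (@wirtinger R) (gauss R nu)) z.
have F_odd : gauss_poly R nu true F.
  have -> : true = odd (p + q) (+) (odd m (+) (odd n (+) false)).
    by rewrite -mnpq_odd !oddD; do 4!case: odd.
  apply: gauss_poly_monomial.
  apply: gauss_poly_iter => [b f /gauss_poly_wirtinger[]//|].
  apply: gauss_poly_iter => [b f /gauss_poly_wirtinger[]//|].
  exact: gauss_poly_gauss.
(* The prefactor of the Hermite polynomial has rate [nu] and the weight rate [- nu / 2]; their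
   product [E] grows, and it is the Gaussian inside [F] that compensates. *)
pose E (z : R[i]) := expR (nu / 2 * Normc.normc z ^+ 2).
have termE z : chi z * z ^+ p * z^*%C ^+ q * cexp (- (nu%:C / 2%:R * `|z| ^+ 2)) *
    complex_hermite nu m n z = chi z * (-1) ^+ (m + n) * (E z)%:C * F z.
  rewrite /complex_hermite -[iter n _ _]/(iter n (@wirtinger R) (gauss R nu)).
  have -> : nu%:C / 2%:R = (nu / 2)%:C by rewrite rmorphM fmorphV rmorph_nat.
  have -> : `|z| ^+ 2 = (Normc.normc z ^+ 2)%:C by rewrite normc_normc rmorphXn.
  rewrite -!rmorphM -rmorphN !cexp_real.
  have -> : E z = expR (- (nu / 2 * Normc.normc z ^+ 2)) * expR (nu * Normc.normc z ^+ 2).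
    by rewrite -expRD /E; congr expR; field.
  by rewrite rmorphM /F /=; ring.
pose T : choiceType := set_type (lattice w1 w2).
pose opp (g : T) : T := exist _ (- val g) (mem_set (latticeN _ _ _ _ (set_mem (valP g)))).
have [K [k [K0 _ F_le]]] := gauss_poly_bound _ _ _ _ F_odd.
pose f (g : T) := chi (val g) * (-1) ^+ (m + n) * (E (val g))%:C * F (val g).
have [M hM] : exists M, forall A : {fset T}, \sum_(g <- A) Normc.normc (f g) <= M.
  apply: (lattice_sum_bounded R w1 w2 nu K k) => // g.
  have chi1 : Normc.normc (chi (val g)) = 1.
    apply: complexI; rewrite -normc_normc; apply: chi_pseudo.1; exact: set_mem (valP g).
  have sgn1 : Normc.normc ((-1) ^+ (m + n) : R[i]) = 1.
    by apply: complexI; rewrite -normc_normc normrX normrN1 expr1n.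
  rewrite /f 3!Normc.normcM chi1 sgn1 normc_real !mul1r ger0_norm ?expR_ge0//.
  (* The growth [nu / 2] of [E] against the decay [nu] of [F] leaves the decay [nu / 2]. *)
  apply: le_trans (ler_wpM2l (expR_ge0 _) (F_le _)) _.
  rewrite mulrCA -expRD ler_wpM2l// ler_expR; lra.
rewrite /has_sum_over; under [X in partial_sum X]eq_fun do rewrite termE.
apply: (partial_sum_odd_cvg0 R T f opp M) => // g.
  by apply: val_inj; rewrite /= opprK.
(* [chi] and [E] are even and [F] is odd, so the whole term changes sign. *)
rewrite /f /= (real_pseudo_character_even _ _ _ _ _ chi_pseudo chi_real); last exact: set_mem (valP g).
rewrite (gauss_poly_parity _ _ _ _ F_odd) /E normcN expr1 mulN1r mulrN.
by [].
Qed.
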